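(* There exists a function $\lambda:(0,\infty)^2\to(0,\infty)$ such that for every non-constant $t\in\mathfrak{T}_1$ with $\Re t>0$ on $\mathbb{T}$ and each choice of sign, $$\|\Psi^{\pm}t\|_\infty\le\lambda(\rho(t),\tau(t))\,n(t)^{\pi/2}.$$
   Context: $\mathbb{T}=\mathbb{R}/\mathbb{Z}$, $e_j(x)=e^{2\pi i jx}$. $\mathfrak{T}_1$: trigonometric polynomials on $\mathbb{T}$; $n^+(t)=\max\mathrm{freq}(t)$, $n^-(t)=-\min\mathrm{freq}(t)$, $n(t)=\max\{n^+(t),n^-(t)\}$; $\|\widehat t\|_1=\sum_j|\widehat t(j)|$. For $\Re t>0$: $\rho(t)=\min\{1,\min\Re t/(2e\|\widehat t\|_1)\}$, $\tau(t)=\max\{\log(\|t\|_\infty+\min\Re t/2),\ \pi/2+|\log(\min\Re t/2)|\}$. For $t$ with $\Re t>0$, $Lt=\log t$ (principal logarithm), $A_\infty^{\pm}g=\tfrac12\widehat g(0)+\sum_{j\ge1}\widehat g(\pm j)e_{\pm j}$, and $\Psi^{\pm}t=\exp(A_\infty^{\pm}(Lt))$. *)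

(* Defs.v *)
From Stdlib Require Import Reals Lra ZArith List Classical ClassicalEpsilon.
Open Scope R_scope.

Definition Cx : Type := (R * R)%type.
Definition C0 : Cx := (0, 0).
Definition Cadd (z w : Cx) : Cx := (fst z + fst w, snd z + snd w).
Definition Cmul (z w : Cx) : Cx :=
  (fst z * fst w - snd z * snd w, fst z * snd w + snd z * fst w).
Definition Cscale (r : R) (z : Cx) : Cx := (r * fst z, r * snd z).
Definition Cnorm (z : Cx) : R := sqrt (fst z ^ 2 + snd z ^ 2).
Definition Cexp (z : Cx) : Cx := (exp (fst z) * cos (snd z), exp (fst z) * sin (snd z)).

Definition Arg (z : Cx) : R :=
  let x := fst z in let y := snd z in
  if Rlt_dec 0 x then atan (y / x)
  else if Rlt_dec x 0 then
         (if Rle_dec 0 y then atan (y / x) + PI else atan (y / x) - PI)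
  else if Rlt_dec 0 y then PI / 2
  else if Rlt_dec y 0 then - (PI / 2)
  else 0.

Definition Clog (z : Cx) : Cx := (ln (Cnorm z), Arg z).

Definition ej (j : Z) (x : R) : Cx :=
  (cos (2 * PI * IZR j * x), sin (2 * PI * IZR j * x)).

Fixpoint Csum (f : nat -> Cx) (n : nat) : Cx :=
  match n with O => C0 | S k => Cadd (Csum f k) (f k) end.
Fixpoint Rsumn (f : nat -> R) (n : nat) : R :=
  match n with O => 0 | S k => Rsumn f k + f k end.

(** Riemann integral over [a,b] (value of RiemannInt when integrable, 0 otherwise;
    RiemannInt does not depend on the integrability proof). *)
Definition RInt (f : R -> R) (a b : R) : R :=
  match excluded_middle_informative (inhabited (Riemann_integrable f a b)) with
  | left H => RiemannInt (epsilon H (fun _ => True))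
  | right _ => 0
  end.

Definition CInt01 (f : R -> Cx) : Cx :=
  (RInt (fun x => fst (f x)) 0 1, RInt (fun x => snd (f x)) 0 1).

Definition fcoef (g : R -> Cx) (j : Z) : Cx :=
  CInt01 (fun x => Cmul (g x) (ej (- j) x)).

Definition Clim (u : nat -> Cx) : Cx :=
  match excluded_middle_informative
          (exists l : Cx, Un_cv (fun n => fst (u n)) (fst l) /\
                         Un_cv (fun n => snd (u n)) (snd l)) with
  | left H => proj1_sig (constructive_indefinite_description _ H)
  | right _ => C0
  end.

Definition sgn (s : bool) : Z := if s then 1%Z else (-1)%Z.

Definition Ainf (s : bool) (g : R -> Cx) (x : R) : Cx :=
  Cadd (Cscale (1/2) (fcoef g 0))
       (Clim (fun M => Csum (fun k => let j := (sgn s * Z.of_nat (S k))%Z in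
                                      Cmul (fcoef g j) (ej j x)) M)).

Definition Psi (s : bool) (t : R -> Cx) (x : R) : Cx :=
  Cexp (Ainf s (fun y => Clog (t y)) x).

(** * Trigonometric polynomials: coefficients c : Z -> Cx supported in [-N, N] *)
Definition supported (N : nat) (c : Z -> Cx) : Prop :=
  forall j : Z, (Z.of_nat N < Z.abs j)%Z -> c j = C0.

Definition idx (N k : nat) : Z := (Z.of_nat k - Z.of_nat N)%Z.

Definition teval (N : nat) (c : Z -> Cx) (x : R) : Cx :=
  Csum (fun k => Cmul (c (idx N k)) (ej (idx N k) x)) (2 * N + 1).

Definition hat_l1 (N : nat) (c : Z -> Cx) : R :=
  Rsumn (fun k => Cnorm (c (idx N k))) (2 * N + 1).

Definition freqs (N : nat) (c : Z -> Cx) : list Z :=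
  filter (fun j => if excluded_middle_informative (c j <> C0) then true else false)
         (map (idx N) (seq 0 (2 * N + 1))).

Definition nplus (N : nat) (c : Z -> Cx) : Z :=
  match freqs N c with nil => 0%Z | j :: l => fold_right Z.max j l end.
Definition nminus (N : nat) (c : Z -> Cx) : Z :=
  (- match freqs N c with nil => 0%Z | j :: l => fold_right Z.min j l end)%Z.
Definition ndeg (N : nat) (c : Z -> Cx) : Z := Z.max (nplus N c) (nminus N c).

Definition Rsup (E : R -> Prop) : R :=
  match excluded_middle_informative (bound E /\ exists x, E x) with
  | left H => proj1_sig (completeness E (proj1 H) (proj2 H))
  | right _ => 0
  end.

Definition supnorm (f : R -> Cx) : R := Rsup (fun r => exists x, r = Cnorm (f x)).
Definition minRe (f : R -> Cx) : R := - Rsup (fun r => exists x, r = - fst (f x)).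

Definition rho (N : nat) (c : Z -> Cx) : R :=
  Rmin 1 (minRe (teval N c) / (2 * exp 1 * hat_l1 N c)).

Definition tau (N : nat) (c : Z -> Cx) : R :=
  Rmax (ln (supnorm (teval N c) + minRe (teval N c) / 2))
       (PI / 2 + Rabs (ln (minRe (teval N c) / 2))).

(* Main.v *)
(** Write [log t = u + i v], so that [|v| <= PI/2]. The real part of the Cesaro mean of the first
    [M] partial sums of [Ainf (log t)] at [x] is [int u F - int v G], where [F >= 0] is half the
    Fejer kernel, of integral 1/2, and [G] is half the conjugate kernel, which is odd with
    [|G z| <= 1 / (2 |z|)] by Jordan's inequality. Hence the first integral is at most [T / 2] with
    [T] an upper bound of [u]; folding the second one onto [0, 1/2] and cutting at [1 / (2 n)], the
    Lipschitz constant [L] of [v] bounds the near part by [L / (2 n)] and [|v| <= PI/2] bounds the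
    far part by [(PI / 2) ln n]. Since [v' = Im (t' / t)], one may take
    [L = 2 PI n hat_l1 / minRe], so [L / (2 n) <= PI / (2 e rho)]. *)

From Coquelicot Require Import Coquelicot.
Require Import Defs.
From Stdlib Require Import Reals ZArith.
From Stdlib Require Import Lra Lia List Classical ClassicalEpsilon.
Open Scope R_scope.

(** * Finite real sums: estimates, continuity, integration *)

Lemma Rsumn_ext (f g : nat -> R) (n : nat) :
  (forall k, (k < n)%nat -> f k = g k) -> Rsumn f n = Rsumn g n.
Proof.
induction n as [|n IH]; simpl; intros H; [reflexivity|].
rewrite IH; [now rewrite H; [|lia]|]. intros k Hk; apply H; lia.
Qed.

Lemma Rsumn_scal (a : R) (f : nat -> R) (n : nat) :
  Rsumn (fun k => a * f k) n = a * Rsumn f n.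
Proof. induction n as [|n IH]; simpl; [|rewrite IH]; ring. Qed.

Lemma Rsumn_le (f g : nat -> R) (n : nat) :
  (forall k, (k < n)%nat -> f k <= g k) -> Rsumn f n <= Rsumn g n.
Proof.
induction n as [|n IH]; simpl; intros H; [lra|].
apply Rplus_le_compat; [apply IH; intros; apply H|apply H]; lia.
Qed.

Lemma Rsumn_Rabs (f : nat -> R) (n : nat) :
  Rabs (Rsumn f n) <= Rsumn (fun k => Rabs (f k)) n.
Proof.
induction n as [|n IH]; simpl; [rewrite Rabs_R0; lra|].
eapply Rle_trans; [apply Rabs_triang|lra].
Qed.

Lemma Rsumn_const (a : R) (n : nat) : Rsumn (fun _ => a) n = INR n * a.
Proof. induction n as [|n IH]; [simpl; ring|]. rewrite S_INR; simpl; rewrite IH; ring. Qed.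

Lemma continuous_Rsumn (F : nat -> R -> R) (n : nat) (x : R) :
  (forall k, continuous (F k) x) -> continuous (fun y => Rsumn (fun k => F k y) n) x.
Proof.
intros H; induction n as [|n IH]; simpl; [apply continuous_const|].
apply (continuous_plus (V := R_NormedModule)); [exact IH|apply H].
Qed.

Lemma is_RInt_Rsumn (F : nat -> R -> R) (l : nat -> R) (a b : R) (n : nat) :
  (forall k, is_RInt (F k) a b (l k)) ->
  is_RInt (fun y => Rsumn (fun k => F k y) n) a b (Rsumn l n).
Proof.
intros H; induction n as [|n IH]; simpl.
- evar_last; [apply @is_RInt_const|apply Rmult_0_r].
- apply (is_RInt_plus (V := R_NormedModule)); [exact IH|apply H].
Qed.

(** * Dirichlet and Fejer kernels and their conjugates, in closed form *)

Definition cos_kernel (m : nat) (al : R) : R :=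
  1 / 2 + Rsumn (fun k => cos (INR (S k) * al)) m.
Definition sin_kernel (m : nat) (al : R) : R :=
  Rsumn (fun k => sin (INR (S k) * al)) m.
(** [cos_kernel] and [sin_kernel] are half the Dirichlet kernel and half its conjugate. Their sums
    are not divided by [M], so [fejer M] and [conj_fejer M] are [M] times the kernels [F] and [G];
    this is the factor [INR M] in all later bounds. *)
Definition fejer (M : nat) (al : R) : R := Rsumn (fun m => cos_kernel m al) M.
Definition conj_fejer (M : nat) (al : R) : R := Rsumn (fun m => sin_kernel m al) M.

(** Telescoping: [2 sin (al / 2) cos (k al)] is the difference of the sines of [(k + 1/2) al] and
    [(k - 1/2) al]. Keeping the factor on the left avoids dividing by a sine that may vanish. *)
Lemma cos_kernel_closed (m : nat) (al : R) :
  2 * sin (al / 2) * cos_kernel m al = sin ((INR m + 1 / 2) * al).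
Proof.
induction m as [|m IH].
- unfold cos_kernel; simpl. replace ((0 + 1 / 2) * al) with (al / 2) by field. field.
- replace (cos_kernel (S m) al) with (cos_kernel m al + cos (INR (S m) * al))
    by (unfold cos_kernel; rewrite Rplus_assoc; reflexivity).
  rewrite Rmult_plus_distr_l, IH, S_INR.
  replace ((INR m + 1 + 1 / 2) * al) with ((INR m + 1) * al + al / 2) by field.
  replace ((INR m + 1 / 2) * al) with ((INR m + 1) * al - al / 2) by field.
  rewrite sin_plus, sin_minus; ring.
Qed.

Lemma sin_kernel_closed (m : nat) (al : R) :
  2 * sin (al / 2) * sin_kernel m al = cos (al / 2) - cos ((INR m + 1 / 2) * al).
Proof.
induction m as [|m IH].
- unfold sin_kernel; simpl. replace ((0 + 1 / 2) * al) with (al / 2) by field. ring.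
- change (sin_kernel (S m) al) with (sin_kernel m al + sin (INR (S m) * al)).
  rewrite Rmult_plus_distr_l, IH, S_INR.
  replace ((INR m + 1 + 1 / 2) * al) with ((INR m + 1) * al + al / 2) by field.
  replace ((INR m + 1 / 2) * al) with ((INR m + 1) * al - al / 2) by field.
  rewrite cos_plus, cos_minus; ring.
Qed.

(** A second telescoping: by [cos_kernel_closed], each new term is
    [2 sin (al / 2) sin ((M + 1/2) al)], which equals [cos (M al) - cos ((M + 1) al)]. *)
Lemma fejer_closed (M : nat) (al : R) :
  4 * (sin (al / 2)) ^ 2 * fejer M al = 1 - cos (INR M * al).
Proof.
induction M as [|M IH].
- unfold fejer; simpl. rewrite Rmult_0_l, cos_0; ring.
- change (fejer (S M) al) with (fejer M al + cos_kernel M al).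
  rewrite Rmult_plus_distr_l, IH, S_INR.
  replace (4 * sin (al / 2) ^ 2 * cos_kernel M al)
    with (2 * sin (al / 2) * (2 * sin (al / 2) * cos_kernel M al)) by ring.
  rewrite cos_kernel_closed.
  replace ((INR M + 1) * al) with ((INR M + 1 / 2) * al + al / 2) by field.
  replace (INR M * al) with ((INR M + 1 / 2) * al - al / 2) by field.
  rewrite cos_plus, cos_minus; ring.
Qed.

Lemma fejer_ge0 (M : nat) (al : R) : 0 <= fejer M al.
Proof.
destruct (Req_dec (sin (al / 2)) 0) as [H0|H0].
(* The closed form says nothing where [sin (al / 2)] vanishes; there every cosine in the sums equals
   1. *)
- assert (Hc : cos al = 1 /\ sin al = 0).
  { replace al with (2 * (al / 2)) by field.
    rewrite cos_2a_sin, sin_2a, H0; split; ring. }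
  assert (Hk : forall k, cos (INR k * al) = 1 /\ sin (INR k * al) = 0).
  { induction k as [|k [IHc IHs]]; [now rewrite Rmult_0_l, cos_0, sin_0|].
    rewrite S_INR, Rmult_plus_distr_r, Rmult_1_l, cos_plus, sin_plus, IHc, IHs.
    destruct Hc as [-> ->]; split; ring. }
  unfold fejer, cos_kernel.
  rewrite <- (Rmult_0_r (INR M)), <- Rsumn_const. apply Rsumn_le; intros m _.
  rewrite (Rsumn_ext _ (fun _ => 1)) by (intros; apply Hk).
  rewrite Rsumn_const. generalize (pos_INR m); lra.
- apply Rmult_le_reg_l with (4 * sin (al / 2) ^ 2).
  + generalize (pow2_gt_0 _ H0); lra.
  + rewrite fejer_closed, Rmult_0_r. generalize (COS_bound (INR M * al)); lra.
Qed.

(** By [sin_kernel_closed], each of the [M] summands times [sin (al / 2)] is half a difference of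
    two cosines, hence at most 1 in absolute value. *)
Lemma Rabs_conj_fejer_le (M : nat) (al : R) :
  Rabs (sin (al / 2)) * Rabs (conj_fejer M al) <= INR M.
Proof.
unfold conj_fejer. rewrite <- Rabs_mult, <- Rsumn_scal.
eapply Rle_trans; [apply Rsumn_Rabs|].
rewrite <- (Rmult_1_r (INR M)), <- Rsumn_const. apply Rsumn_le; intros m _.
generalize (sin_kernel_closed m al) (COS_bound (al / 2)) (COS_bound ((INR m + 1 / 2) * al)).
intros H1 H2 H3. apply Rabs_le; lra.
Qed.

Lemma conj_fejer_odd (M : nat) (al : R) : conj_fejer M (- al) = - conj_fejer M al.
Proof.
unfold conj_fejer, sin_kernel.
replace (- Rsumn (fun m => Rsumn (fun k => sin (INR (S k) * al)) m) M)
  with (-1 * Rsumn (fun m => Rsumn (fun k => sin (INR (S k) * al)) m) M) by ring.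
rewrite <- Rsumn_scal. apply Rsumn_ext; intros m _.
rewrite <- Rsumn_scal. apply Rsumn_ext; intros k _.
rewrite Ropp_mult_distr_r_reverse, sin_neg; ring.
Qed.

(** Concavity of the sine: [f] vanishes at 0 and at 1/2. A negative value at [z] would force, by the
    mean value theorem, a negative slope before [z] and a positive one after it, while [f']
    decreases with the cosine. *)
Lemma jordan_sin (z : R) : 0 <= z <= 1 / 2 -> 2 * z <= sin (PI * z).
Proof.
intros Hz. generalize PI_RGT_0; intros Hpi.
destruct (Rle_lt_dec (2 * z) (sin (PI * z))) as [|Hlt]; [assumption|exfalso].
assert (Hz0 : 0 < z).
{ destruct (Req_dec z 0) as [->|]; [rewrite Rmult_0_r, sin_0 in Hlt; lra|lra]. }
assert (Hz1 : z < 1 / 2).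
{ destruct (Req_dec z (1 / 2)) as [->|]; [|lra].
  replace (PI * (1 / 2)) with (PI / 2) in Hlt by field. rewrite sin_PI2 in Hlt; lra. }
set (f := fun y => sin (PI * y) - 2 * y).
assert (Hd : forall y, is_derive f y (PI * cos (PI * y) - 2)).
{ intros y; unfold f; auto_derive; [trivial|ring]. }
assert (Hf0 : f 0 = 0) by (unfold f; rewrite Rmult_0_r, sin_0; ring).
assert (Hf1 : f (1 / 2) = 0).
{ unfold f; replace (PI * (1 / 2)) with (PI / 2) by field. rewrite sin_PI2; field. }
destruct (MVT_cor2 f (fun y => PI * cos (PI * y) - 2) 0 z Hz0) as [c1 [E1 B1]].
{ intros; apply is_derive_Reals, Hd. }
destruct (MVT_cor2 f (fun y => PI * cos (PI * y) - 2) z (1 / 2) Hz1) as [c2 [E2 B2]].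
{ intros; apply is_derive_Reals, Hd. }
assert (Hfz : f z < 0) by (unfold f; lra).
assert (Hc : cos (PI * c2) < cos (PI * c1)).
{ apply cos_decreasing_1; nra. }
assert (PI * cos (PI * c1) - 2 < 0) by (apply Rmult_lt_reg_r with z; lra).
assert (0 < PI * cos (PI * c2) - 2) by (apply Rmult_lt_reg_r with (1 / 2 - z); lra).
nra.
Qed.

(** * Integrals of periodic functions over a shifted or folded period *)

Lemma RInt_shift_periodic (h : R -> R) (x : R) :
  (forall y, continuous h y) -> (forall y, h (y + 1) = h y) ->
  is_RInt h (x - 1 / 2) (x + 1 / 2) (RInt.RInt h 0 1).
Proof.
intros Hc Hp.
assert (Hex : forall a b, ex_RInt h a b)
  by (intros; apply (ex_RInt_continuous (V := R_CompleteNormedModule)); auto).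
(* Splitting at 0 and 1 leaves the integral over [0, 1] and two end pieces, which cancel by this
   translation through one period. *)
assert (E : RInt.RInt h 1 (x + 1 / 2) = RInt.RInt h 0 (x - 1 / 2)).
{ symmetry; apply is_RInt_unique.
  apply is_RInt_ext with (fun y => scal 1 (h (1 * y + 1))).
  { intros y _; unfold scal; simpl; unfold mult; simpl; rewrite !Rmult_1_l; apply Hp. }
  apply (is_RInt_comp_lin h 1 1 0 (x - 1 / 2)).
  replace (1 * 0 + 1) with 1 by ring.
  replace (1 * (x - 1 / 2) + 1) with (x + 1 / 2) by field.
  apply (RInt_correct (V := R_CompleteNormedModule)), Hex. }
evar_last; [apply (RInt_correct (V := R_CompleteNormedModule)), Hex|].
rewrite <- (RInt_Chasles h (x - 1 / 2) 0 (x + 1 / 2)) by apply Hex.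
rewrite <- (RInt_Chasles h 0 1 (x + 1 / 2)) by apply Hex.
rewrite E, <- (opp_RInt_swap h) by apply Hex.
unfold plus, opp; simpl; ring.
Qed.

(** Pairs the points [x + z] and [x - z], so that an odd kernel centred at [x] will meet a
    difference of values. *)
Lemma is_RInt_fold_periodic (h : R -> R) (x : R) :
  (forall y, continuous h y) -> (forall y, h (y + 1) = h y) ->
  is_RInt (fun z => h (x + z) + h (x - z)) 0 (1 / 2) (RInt.RInt h 0 1).
Proof.
intros Hc Hp.
assert (Hex : forall a b, ex_RInt h a b)
  by (intros; apply (ex_RInt_continuous (V := R_CompleteNormedModule)); auto).
assert (H1 : is_RInt (fun z => h (x + z)) 0 (1 / 2) (RInt.RInt h x (x + 1 / 2))).
{ apply is_RInt_ext with (fun z => scal 1 (h (1 * z + x))).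
  { intros; unfold scal; simpl; unfold mult; simpl; rewrite Rmult_1_l; f_equal; ring. }
  apply (is_RInt_comp_lin h 1 x 0 (1 / 2)).
  replace (1 * 0 + x) with x by ring. replace (1 * (1 / 2) + x) with (x + 1 / 2) by ring.
  apply (RInt_correct (V := R_CompleteNormedModule)), Hex. }
assert (H2 : is_RInt (fun z => h (x - z)) 0 (1 / 2) (RInt.RInt h (x - 1 / 2) x)).
{ rewrite <- (Ropp_involutive (RInt.RInt h (x - 1 / 2) x)).
  apply is_RInt_ext with (fun z => opp (scal (-1) (h (-1 * z + x)))).
  { intros; unfold opp, scal; simpl; unfold mult; simpl.
    replace (-1 * x0 + x) with (x - x0) by ring. ring. }
  apply (is_RInt_opp (V := R_NormedModule)).
  apply (is_RInt_comp_lin h (-1) x 0 (1 / 2)).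
  replace (-1 * 0 + x) with x by ring. replace (-1 * (1 / 2) + x) with (x - 1 / 2) by ring.
  apply (is_RInt_swap (V := R_NormedModule)).
  apply (RInt_correct (V := R_CompleteNormedModule)), Hex. }
evar_last; [apply (is_RInt_plus (V := R_NormedModule) _ _ _ _ _ _ H1 H2)|].
rewrite <- (is_RInt_unique _ _ _ _ (RInt_shift_periodic h x Hc Hp)).
rewrite <- (RInt_Chasles h (x - 1 / 2) x (x + 1 / 2)) by apply Hex.
unfold plus; simpl; ring.
Qed.

(** * Integer frequencies and the kernels on the circle *)

Lemma cos_sin_2PI_IZR (j : Z) : cos (2 * PI * IZR j) = 1 /\ sin (2 * PI * IZR j) = 0.
Proof.
assert (Hn : forall k : nat, cos (2 * PI * INR k) = 1 /\ sin (2 * PI * INR k) = 0).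
{ intros k; replace (2 * PI * INR k) with (0 + 2 * INR k * PI) by ring.
  now rewrite cos_period, sin_period, cos_0, sin_0. }
destruct (Z_le_gt_dec 0 j) as [Hj|Hj].
- rewrite <- (Z2Nat.id j Hj), <- INR_IZR_INZ. apply Hn.
- replace j with (- Z.of_nat (Z.to_nat (- j)))%Z by lia.
  rewrite opp_IZR, <- INR_IZR_INZ, Ropp_mult_distr_r_reverse, cos_neg, sin_neg.
  destruct (Hn (Z.to_nat (- j))) as [-> ->]; split; ring.
Qed.

Lemma cos_IZR_periodic (j : Z) (y : R) :
  cos (2 * PI * IZR j * (y + 1)) = cos (2 * PI * IZR j * y).
Proof.
rewrite Rmult_plus_distr_l, Rmult_1_r, cos_plus.
destruct (cos_sin_2PI_IZR j) as [-> ->]; ring.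
Qed.

Lemma sin_IZR_periodic (j : Z) (y : R) :
  sin (2 * PI * IZR j * (y + 1)) = sin (2 * PI * IZR j * y).
Proof.
rewrite Rmult_plus_distr_l, Rmult_1_r, sin_plus.
destruct (cos_sin_2PI_IZR j) as [-> ->]; ring.
Qed.

Lemma is_RInt_cos_IZR (j : Z) (x : R) : j <> 0%Z ->
  is_RInt (fun y => cos (2 * PI * IZR j * (x - y))) 0 1 0.
Proof.
intros Hj. assert (HR : IZR j <> 0) by (now apply not_0_IZR).
generalize PI_RGT_0; intros Hpi.
evar_last.
- apply (is_RInt_derive (V := R_CompleteNormedModule)
    (fun y => - (sin (2 * PI * IZR j * (x - y)) / (2 * PI * IZR j)))).
  + intros y _. auto_derive; [trivial|]. unfold Rminus; field; split; [assumption|lra].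
  + intros y _. apply (ex_derive_continuous (V := R_NormedModule)). auto_derive; trivial.
- unfold minus, plus, opp; simpl.
  replace (2 * PI * IZR j * (x - 0)) with (2 * PI * IZR j * ((x - 1) + 1)) by ring.
  rewrite sin_IZR_periodic. ring.
Qed.

Definition freq_sgn (s : bool) (k : nat) : Z := (sgn s * Z.of_nat (S k))%Z.

(** Moves the sign of the frequency into the angle, so that the same kernels serve both choices of
    [s]. *)
Lemma freq_sgn_angle (s : bool) (k : nat) (z : R) :
  INR (S k) * (2 * PI * IZR (sgn s) * z) = 2 * PI * IZR (freq_sgn s k) * z.
Proof. unfold freq_sgn. rewrite mult_IZR, <- INR_IZR_INZ. ring. Qed.

(** Only the constant 1/2 of each [cos_kernel] survives integration over a period. *)
Lemma is_RInt_fejer (s : bool) (M : nat) (x : R) :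
  is_RInt (fun y => fejer M (2 * PI * IZR (sgn s) * (x - y))) 0 1 (INR M / 2).
Proof.
replace (INR M / 2) with (Rsumn (fun _ => 1 / 2) M) by (rewrite Rsumn_const; field).
apply (is_RInt_Rsumn (fun m y => cos_kernel m (2 * PI * IZR (sgn s) * (x - y)))).
intros m. unfold cos_kernel. evar_last.
- apply (is_RInt_plus (V := R_NormedModule)).
  + apply @is_RInt_const.
  + apply (is_RInt_Rsumn (fun k y => cos (INR (S k) * (2 * PI * IZR (sgn s) * (x - y))))
             (fun _ => 0)).
    intros k. apply is_RInt_ext with (fun y => cos (2 * PI * IZR (freq_sgn s k) * (x - y))).
    { intros y _; now rewrite freq_sgn_angle. }
    apply is_RInt_cos_IZR. unfold freq_sgn, sgn; destruct s; lia.
- rewrite Rsumn_const. unfold plus, scal; simpl; unfold mult; simpl. field.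
Qed.

Lemma continuous_fejer (M : nat) (c x y : R) :
  continuous (fun y => fejer M (c * (x - y))) y.
Proof.
apply (continuous_Rsumn (fun m y => cos_kernel m (c * (x - y)))); intros m.
apply (continuous_plus (V := R_NormedModule)); [apply continuous_const|].
apply (continuous_Rsumn (fun k y => cos (INR (S k) * (c * (x - y))))); intros k.
apply (ex_derive_continuous (V := R_NormedModule)). auto_derive; trivial.
Qed.

Lemma continuous_conj_fejer (M : nat) (c x y : R) :
  continuous (fun y => conj_fejer M (c * (x - y))) y.
Proof.
apply (continuous_Rsumn (fun m y => sin_kernel m (c * (x - y)))); intros m.
apply (continuous_Rsumn (fun k y => sin (INR (S k) * (c * (x - y))))); intros k.
apply (ex_derive_continuous (V := R_NormedModule)). auto_derive; trivial.
Qed.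

(** Half the angle is [PI * z] up to sign, so [jordan_sin] replaces the sine in [Rabs_conj_fejer_le]
    by [2 * z]. *)
Lemma conj_fejer_bound (M : nat) (s : bool) (z : R) : 0 <= z <= 1 / 2 ->
  2 * z * Rabs (conj_fejer M (2 * PI * IZR (sgn s) * z)) <= INR M.
Proof.
intros Hz. eapply Rle_trans; [|apply Rabs_conj_fejer_le with (al := 2 * PI * IZR (sgn s) * z)].
apply Rmult_le_compat_r; [apply Rabs_pos|].
eapply Rle_trans; [apply (jordan_sin z Hz)|].
destruct s; simpl sgn.
- replace (2 * PI * 1 * z / 2) with (PI * z) by field. apply Rle_abs.
- replace (2 * PI * -1 * z / 2) with (- (PI * z)) by field.
  rewrite sin_neg, Rabs_Ropp. apply Rle_abs.
Qed.

Lemma conj_fejer_periodic (M : nat) (s : bool) (x y : R) :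
  conj_fejer M (2 * PI * IZR (sgn s) * (x - (y + 1)))
  = conj_fejer M (2 * PI * IZR (sgn s) * (x - y)).
Proof.
apply Rsumn_ext; intros m _. apply Rsumn_ext; intros k _. rewrite !freq_sgn_angle.
replace (x - y) with ((x - (y + 1)) + 1) by ring. now rewrite sin_IZR_periodic.
Qed.

(** * Integrals against the conjugate kernel and against the Fejer kernel *)

Lemma is_RInt_conj_fejer_bound (v : R -> R) (L n x l : R) (M : nat) (s : bool) :
  (forall y, continuous v y) -> (forall y, v (y + 1) = v y) ->
  (forall y, Rabs (v y) <= PI / 2) ->
  (forall y z, Rabs (v y - v z) <= L * Rabs (y - z)) -> 1 <= n ->
  is_RInt (fun y => v y * conj_fejer M (2 * PI * IZR (sgn s) * (x - y))) 0 1 l ->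
  - l <= INR M * (PI / 2 * ln n + L / (2 * n)).
Proof.
intros Hc Hp Hb HL Hn Hl.
set (h := fun y => v y * conj_fejer M (2 * PI * IZR (sgn s) * (x - y))) in Hl.
assert (Hhc : forall y, continuous h y).
{ intros y; apply (continuous_mult (K := R_AbsRing)); [apply Hc|apply continuous_conj_fejer]. }
assert (Hhp : forall y, h (y + 1) = h y).
{ intros y; unfold h; now rewrite Hp, conj_fejer_periodic. }
generalize (is_RInt_fold_periodic h x Hhc Hhp); intros HG.
rewrite (is_RInt_unique _ _ _ _ Hl) in HG.
apply (is_RInt_opp (V := R_NormedModule)) in HG.
set (G := fun z => opp (h (x + z) + h (x - z))) in HG.
(* Oddness of [conj_fejer] turns the folded sum into a difference of values of [v], small near
   [z = 0]. *)
assert (HGE : forall z, G z = (v (x + z) - v (x - z)) * conj_fejer M (2 * PI * IZR (sgn s) * z)).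
{ intros z; unfold G, h, opp; simpl.
  replace (2 * PI * IZR (sgn s) * (x - (x + z))) with (- (2 * PI * IZR (sgn s) * z)) by ring.
  replace (x - (x - z)) with z by ring. rewrite conj_fejer_odd. ring. }
assert (HGc : forall z, continuous G z).
{ intros z; apply (continuous_opp (V := R_NormedModule)).
  apply (continuous_plus (V := R_NormedModule)).
  - apply (continuous_comp (fun z => x + z) h); [|apply Hhc].
    apply (ex_derive_continuous (V := R_NormedModule)); auto_derive; trivial.
  - apply (continuous_comp (fun z => x - z) h); [|apply Hhc].
    apply (ex_derive_continuous (V := R_NormedModule)); auto_derive; trivial. }
assert (Hex : forall a b, ex_RInt G a b)
  by (intros; apply (ex_RInt_continuous (V := R_CompleteNormedModule)); auto).
(* This cut makes the integral of [/ z] over the far part, from [d] to 1/2, exactly [ln n]; [1 <= n]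
   keeps it inside [0, 1/2]. *)
set (d := / (2 * n)).
assert (Hd : 0 < d <= 1 / 2).
{ unfold d; split; [apply Rinv_0_lt_compat; lra|].
  replace (1 / 2) with (/ 2) by field. apply Rinv_le_contravar; lra. }
(* The Lipschitz bound [L * (2 * z)] cancels the singularity of the kernel, so [G] is at most
   [INR M * L] here. *)
assert (Hnear : RInt.RInt G 0 d <= d * (INR M * L)).
{ apply (is_RInt_le G (fun _ => INR M * L) 0 d); [lra| | |].
  - apply (RInt_correct (V := R_CompleteNormedModule)), Hex.
  - evar_last; [apply @is_RInt_const|]. unfold scal; simpl; unfold mult; simpl; ring.
  - intros z Hz. rewrite HGE. eapply Rle_trans; [apply Rle_abs|]. rewrite Rabs_mult.
    assert (Hq := conj_fejer_bound M s z ltac:(lra)).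
    assert (Hv := HL (x + z) (x - z)).
    replace (x + z - (x - z)) with (2 * z) in Hv by ring.
    rewrite (Rabs_pos_eq (2 * z)) in Hv by lra.
    assert (HL0 : 0 <= L) by (generalize (Rabs_pos (v (x + z) - v (x - z))); nra).
    eapply Rle_trans; [apply Rmult_le_compat_r; [apply Rabs_pos|apply Hv]|].
    rewrite Rmult_assoc, (Rmult_comm (INR M)). now apply Rmult_le_compat_l. }
(* The difference of values of [v] is at most [PI] and the kernel at most [INR M / (2 * z)]: this is
   the source of the exponent [PI / 2]. *)
assert (Hfar : RInt.RInt G d (1 / 2) <= INR M * (PI / 2) * ln n).
{ apply (is_RInt_le G (fun z => INR M * (PI / 2) * / z) d (1 / 2)); [lra| | |].
  - apply (RInt_correct (V := R_CompleteNormedModule)), Hex.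
  - evar_last.
    + apply (is_RInt_derive (V := R_CompleteNormedModule) (fun z => INR M * (PI / 2) * ln z)).
      * intros z Hz. rewrite Rmin_left, Rmax_right in Hz by lra.
        auto_derive; [lra|field; lra].
      * intros z Hz. rewrite Rmin_left, Rmax_right in Hz by lra.
        apply (ex_derive_continuous (V := R_NormedModule)). auto_derive. lra.
    + unfold minus, plus, opp; simpl. unfold d.
      rewrite ln_Rinv, ln_mult by lra. replace (1 / 2) with (/ 2) by field.
      rewrite ln_Rinv by lra. ring.
  - intros z Hz. rewrite HGE. eapply Rle_trans; [apply Rle_abs|]. rewrite Rabs_mult.
    assert (Hq := conj_fejer_bound M s z ltac:(lra)).
    assert (Hv : Rabs (v (x + z) - v (x - z)) <= PI).
    { generalize (Hb (x + z)) (Hb (x - z)); intros H1 H2.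
      apply Rabs_le_between in H1, H2. apply Rabs_le. lra. }
    eapply Rle_trans; [apply Rmult_le_compat_r; [apply Rabs_pos|apply Hv]|].
    apply Rmult_le_reg_l with (2 * z); [lra|].
    replace (2 * z * (INR M * (PI / 2) * / z)) with (PI * INR M) by (field; lra).
    rewrite (Rmult_comm PI), <- Rmult_assoc, (Rmult_comm PI).
    apply Rmult_le_compat_r; [generalize PI_RGT_0; lra|assumption]. }
replace (- l) with (RInt.RInt G 0 d + RInt.RInt G d (1 / 2)).
2:{ rewrite <- (is_RInt_unique G 0 (1 / 2) (- l) HG).
    apply (RInt_Chasles G 0 d (1 / 2)); apply Hex. }
replace (L / (2 * n)) with (d * L) by (unfold d; field; lra).
lra.
Qed.

(** Since the kernel is nonnegative, replacing [u] by the constant [T] can only increase the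
    integral. *)
Lemma is_RInt_fejer_bound (u : R -> R) (T x l : R) (M : nat) (s : bool) :
  (forall y, u y <= T) ->
  is_RInt (fun y => u y * fejer M (2 * PI * IZR (sgn s) * (x - y))) 0 1 l ->
  l <= INR M * (T / 2).
Proof.
intros HT Hl.
apply (is_RInt_le _ (fun y => T * fejer M (2 * PI * IZR (sgn s) * (x - y))) 0 1 _ _
         Rle_0_1 Hl).
- evar_last.
  + apply (is_RInt_scal (V := R_NormedModule)), is_RInt_fejer.
  + unfold scal; simpl; unfold mult; simpl; field.
- intros y _. apply Rmult_le_compat_r; [apply fejer_ge0|apply HT].
Qed.

(** Links the two integrals in use: for continuous [f], the [RInt] of the definitions is not its
    default 0 and agrees with [RInt.RInt]. *)
Lemma is_RInt_RInt (f : R -> R) (a b : R) :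
  (forall y, continuous f y) -> is_RInt f a b (RInt f a b).
Proof.
intros Hf.
assert (Hex : ex_RInt f a b)
  by (apply (ex_RInt_continuous (V := R_CompleteNormedModule)); auto).
unfold RInt. destruct (excluded_middle_informative _) as [H|H].
- rewrite <- RInt_Reals. now apply (RInt_correct (V := R_CompleteNormedModule)).
- exfalso; apply H; constructor; now apply ex_RInt_Reals_0.
Qed.

(** * Cesaro means of the partial sums of [Ainf] as kernel integrals *)

Section ConjugateMean.

Variables (g : R -> Cx) (s : bool) (x : R).
Hypothesis g_cont : forall y, continuous (fun y => fst (g y)) y.
Hypothesis g_cont' : forall y, continuous (fun y => snd (g y)) y.

(** The phase [ej j x] is taken under the integral of [fcoef], where it merges with [ej (- j) y]
    into the character at [x - y]; the integrand is the real part of the product. *)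
Lemma is_RInt_fcoef_ej (j : Z) :
  is_RInt (fun y => fst (g y) * cos (2 * PI * IZR j * (x - y))
                    - snd (g y) * sin (2 * PI * IZR j * (x - y))) 0 1
    (fst (Cmul (fcoef g j) (ej j x))).
Proof.
assert (Hcos : forall y, continuous (fun y => cos (2 * PI * IZR (- j) * y)) y)
  by (intros y; apply (ex_derive_continuous (V := R_NormedModule)); auto_derive; trivial).
assert (Hsin : forall y, continuous (fun y => sin (2 * PI * IZR (- j) * y)) y)
  by (intros y; apply (ex_derive_continuous (V := R_NormedModule)); auto_derive; trivial).
assert (H1 : is_RInt (fun y => fst (Cmul (g y) (ej (- j) y))) 0 1 (fst (fcoef g j))).
{ apply is_RInt_RInt; intros y. apply (continuous_minus (V := R_NormedModule));
    apply (continuous_mult (K := R_AbsRing)); auto. }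
assert (H2 : is_RInt (fun y => snd (Cmul (g y) (ej (- j) y))) 0 1 (snd (fcoef g j))).
{ apply is_RInt_RInt; intros y. apply (continuous_plus (V := R_NormedModule));
    apply (continuous_mult (K := R_AbsRing)); auto. }
apply (is_RInt_scal (V := R_NormedModule)) with (k := cos (2 * PI * IZR j * x)) in H1.
apply (is_RInt_scal (V := R_NormedModule)) with (k := sin (2 * PI * IZR j * x)) in H2.
generalize (is_RInt_minus (V := R_NormedModule) _ _ _ _ _ _ H1 H2); intros H.
evar_last; [eapply is_RInt_ext; [|exact H]|].
- intros y _. unfold minus, plus, opp, scal; simpl; unfold mult; simpl.
  rewrite opp_IZR. replace (2 * PI * - IZR j * y) with (- (2 * PI * IZR j * y)) by ring.
  replace (2 * PI * IZR j * (x - y)) with (2 * PI * IZR j * x - 2 * PI * IZR j * y) by ring.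
  rewrite cos_minus, sin_minus, cos_neg, sin_neg. ring.
- unfold minus, plus, opp, scal; simpl; unfold mult; simpl. ring.
Qed.

(** Only the real part is followed, because it alone determines the modulus of the exponential. *)
Definition Ainf_partial (m : nat) : R :=
  1 / 2 * fst (fcoef g 0)
  + fst (Csum (fun k => Cmul (fcoef g (freq_sgn s k)) (ej (freq_sgn s k) x)) m).

(** The weight 1/2 of the zero frequency becomes the constant of [cos_kernel], and each further
    frequency adds one term to both kernels. *)
Lemma is_RInt_Ainf_partial (m : nat) :
  is_RInt (fun y => fst (g y) * cos_kernel m (2 * PI * IZR (sgn s) * (x - y))
                    - snd (g y) * sin_kernel m (2 * PI * IZR (sgn s) * (x - y))) 0 1
    (Ainf_partial m).
Proof.
induction m as [|m IH].
- generalize (is_RInt_scal (V := R_NormedModule) _ _ _ (1 / 2) _ (is_RInt_fcoef_ej 0)).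
  intros H. evar_last; [eapply is_RInt_ext; [|exact H]|].
  + intros y _. unfold scal, cos_kernel, sin_kernel; simpl; unfold mult; simpl.
    replace (2 * PI * 0 * (x - y)) with 0 by ring. rewrite cos_0, sin_0. ring.
  + unfold Ainf_partial, scal; simpl; unfold mult; simpl.
    replace (2 * PI * 0 * x) with 0 by ring. rewrite cos_0, sin_0. ring.
- generalize (is_RInt_plus (V := R_NormedModule) _ _ _ _ _ _ IH
                (is_RInt_fcoef_ej (freq_sgn s m))).
  intros H. evar_last; [eapply is_RInt_ext; [|exact H]|].
  + intros y _; cbv beta. rewrite <- !freq_sgn_angle.
    set (al := 2 * PI * IZR (sgn s) * (x - y)).
    change (sin_kernel (S m) al) with (sin_kernel m al + sin (INR (S m) * al)).
    replace (cos_kernel (S m) al) with (cos_kernel m al + cos (INR (S m) * al))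
      by (unfold cos_kernel; rewrite Rplus_assoc; reflexivity).
    match goal with |- plus ?a ?b = ?c => change (a + b = c) end. ring.
  + unfold Ainf_partial. exact (Rplus_assoc _ _ _).
Qed.

Lemma is_RInt_cesaro (M : nat) :
  is_RInt (fun y => fst (g y) * fejer M (2 * PI * IZR (sgn s) * (x - y))
                    - snd (g y) * conj_fejer M (2 * PI * IZR (sgn s) * (x - y))) 0 1
    (Rsumn Ainf_partial M).
Proof.
eapply is_RInt_ext; [|apply is_RInt_Rsumn, is_RInt_Ainf_partial].
intros y _. unfold fejer, conj_fejer. induction M as [|M IH]; simpl; [ring|].
rewrite IH; ring.
Qed.

Variables (T L n : R).
Hypothesis g_period : forall y, snd (g (y + 1)) = snd (g y).
Hypothesis g_upper : forall y, fst (g y) <= T.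
Hypothesis g_bound : forall y, Rabs (snd (g y)) <= PI / 2.
Hypothesis g_lip : forall y z, Rabs (snd (g y) - snd (g z)) <= L * Rabs (y - z).
Hypothesis n_ge1 : 1 <= n.

Lemma cesaro_bound (M : nat) :
  Rsumn Ainf_partial M <= INR M * (T / 2 + (PI / 2 * ln n + L / (2 * n))).
Proof.
assert (H1 : is_RInt (fun y => fst (g y) * fejer M (2 * PI * IZR (sgn s) * (x - y))) 0 1
  (RInt (fun y => fst (g y) * fejer M (2 * PI * IZR (sgn s) * (x - y))) 0 1)).
{ apply is_RInt_RInt; intros y.
  apply (continuous_mult (K := R_AbsRing)); [apply g_cont|apply continuous_fejer]. }
assert (H2 : is_RInt (fun y => snd (g y) * conj_fejer M (2 * PI * IZR (sgn s) * (x - y))) 0 1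
  (RInt (fun y => snd (g y) * conj_fejer M (2 * PI * IZR (sgn s) * (x - y))) 0 1)).
{ apply is_RInt_RInt; intros y.
  apply (continuous_mult (K := R_AbsRing)); [apply g_cont'|apply continuous_conj_fejer]. }
generalize (is_RInt_minus (V := R_NormedModule) _ _ _ _ _ _ H1 H2); intros H.
rewrite <- (is_RInt_unique _ _ _ _ (is_RInt_cesaro M)).
eapply Rle_trans; [apply Req_le, (is_RInt_unique _ _ _ _ H)|].
apply is_RInt_fejer_bound with (T := T) in H1; [|apply g_upper].
apply is_RInt_conj_fejer_bound with (L := L) (n := n) in H2; try assumption.
unfold minus, plus, opp; simpl. rewrite Rmult_plus_distr_l.
apply Rplus_le_compat; assumption.
Qed.

(* [Clim] is [C0] on divergent sequences; in that case only the zeroth partial sum matters. *)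
Lemma fst_Ainf_bound : fst (Ainf s g x) <= T / 2 + (PI / 2 * ln n + L / (2 * n)).
Proof.
set (B := T / 2 + (PI / 2 * ln n + L / (2 * n))).
unfold Ainf, Clim. destruct (excluded_middle_informative _) as [H|H].
- destruct (constructive_indefinite_description _ H) as [l [Hl Hl']]; simpl proj1_sig.
  assert (Hlim : Un_cv Ainf_partial (1 / 2 * fst (fcoef g 0) + fst l)).
  { apply CV_plus; [|exact Hl].
    intros e He; exists 0%nat; intros; unfold Rdist. rewrite Rminus_diag, Rabs_R0; exact He. }
  (* The Cesaro means converge to the limit of the partial sums, so their uniform bound passes to
     it. The shift by one discards index 0, where the divisor is [INR 0]. *)
  apply Cesaro_1, is_lim_seq_Reals in Hlim. apply is_lim_seq_incr_1 in Hlim.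
  apply (is_lim_seq_le _ (fun _ => B) (1 / 2 * fst (fcoef g 0) + fst l) B) in Hlim;
    [exact Hlim| |apply is_lim_seq_const].
  intros M. simpl Init.Nat.pred.
  apply Rmult_le_reg_l with (INR (S M)); [apply lt_0_INR; lia|].
  replace (INR (S M) * (sum_f_R0 Ainf_partial M / INR (S M)))
    with (sum_f_R0 Ainf_partial M) by (field; apply not_0_INR; lia).
  replace (sum_f_R0 Ainf_partial M) with (Rsumn Ainf_partial (S M));
    [apply cesaro_bound|].
  induction M as [|M IH]; [simpl; ring|].
  change (Rsumn Ainf_partial (S M) + Ainf_partial (S M) = sum_f_R0 Ainf_partial (S M)).
  now rewrite IH.
- generalize (cesaro_bound 1). fold B. unfold Ainf_partial; simpl. lra.
Qed.

End ConjugateMean.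

(** * Suprema, complex norms, and derivatives of trigonometric polynomials *)

Lemma is_lub_Rsup (E : R -> Prop) : bound E -> (exists r, E r) -> is_lub E (Rsup E).
Proof.
intros Hb He. unfold Rsup. destruct (excluded_middle_informative _) as [H|H].
- destruct (completeness _ _ _) as [l Hl]; exact Hl.
- exfalso; apply H; now split.
Qed.

(** [Cx] and [Cnorm] are convertible with the complex numbers and [Cmod] of Coquelicot, whose lemmas
    therefore apply directly. *)
Lemma Cnorm_C0 : Cnorm C0 = 0.
Proof. exact Cmod_0. Qed.

Lemma Cnorm_Csum (f : nat -> Cx) (n : nat) :
  Cnorm (Csum f n) <= Rsumn (fun k => Cnorm (f k)) n.
Proof.
induction n as [|n IH]; simpl.
- rewrite Cnorm_C0; lra.
- eapply Rle_trans; [apply (Cmod_triangle (Csum f n) (f n))|].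
  apply Rplus_le_compat_r, IH.
Qed.

Lemma Cnorm_Cmul (z w : Cx) : Cnorm (Cmul z w) = Cnorm z * Cnorm w.
Proof. exact (Cmod_mult z w). Qed.

Lemma Cnorm_ej (j : Z) (x : R) : Cnorm (ej j x) = 1.
Proof.
unfold Cnorm, ej; simpl fst; simpl snd. rewrite <- !Rsqr_pow2, Rplus_comm, sin2_cos2.
apply sqrt_1.
Qed.

Lemma Csum_ext (f g : nat -> Cx) (n : nat) :
  (forall k, (k < n)%nat -> f k = g k) -> Csum f n = Csum g n.
Proof.
induction n as [|n IH]; simpl; intros H; [reflexivity|].
rewrite IH; [now rewrite H; [|lia]|]. intros k Hk; apply H; lia.
Qed.

Lemma is_derive_fst_Csum (F dF : nat -> R -> Cx) (n : nat) (x : R) :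
  (forall k, is_derive (fun y => fst (F k y)) x (fst (dF k x))) ->
  is_derive (fun y => fst (Csum (fun k => F k y) n)) x (fst (Csum (fun k => dF k x) n)).
Proof.
intros H; induction n as [|n IH]; simpl.
- apply (is_derive_const (V := R_NormedModule)).
- apply (is_derive_plus (V := R_NormedModule)); [exact IH|apply H].
Qed.

Lemma is_derive_snd_Csum (F dF : nat -> R -> Cx) (n : nat) (x : R) :
  (forall k, is_derive (fun y => snd (F k y)) x (snd (dF k x))) ->
  is_derive (fun y => snd (Csum (fun k => F k y) n)) x (snd (Csum (fun k => dF k x) n)).
Proof.
intros H; induction n as [|n IH]; simpl.
- apply (is_derive_const (V := R_NormedModule)).
- apply (is_derive_plus (V := R_NormedModule)); [exact IH|apply H].
Qed.

Definition dej (j : Z) (x : R) : Cx := Cmul (0, 2 * PI * IZR j) (ej j x).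

Definition dteval (N : nat) (c : Z -> Cx) (x : R) : Cx :=
  Csum (fun k => Cmul (c (idx N k)) (dej (idx N k) x)) (2 * N + 1).

Lemma is_derive_fst_teval (N : nat) (c : Z -> Cx) (x : R) :
  is_derive (fun y => fst (teval N c y)) x (fst (dteval N c x)).
Proof.
apply (is_derive_fst_Csum (fun k y => Cmul (c (idx N k)) (ej (idx N k) y))
         (fun k y => Cmul (c (idx N k)) (dej (idx N k) y))).
intros k. unfold Cmul, dej, ej; simpl. auto_derive; [trivial|ring].
Qed.

Lemma is_derive_snd_teval (N : nat) (c : Z -> Cx) (x : R) :
  is_derive (fun y => snd (teval N c y)) x (snd (dteval N c x)).
Proof.
apply (is_derive_snd_Csum (fun k y => Cmul (c (idx N k)) (ej (idx N k) y))
         (fun k y => Cmul (c (idx N k)) (dej (idx N k) y))).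
intros k. unfold Cmul, dej, ej; simpl. auto_derive; [trivial|ring].
Qed.

Lemma teval_periodic (N : nat) (c : Z -> Cx) (x : R) : teval N c (x + 1) = teval N c x.
Proof.
apply Csum_ext; intros k _. unfold ej. now rewrite cos_IZR_periodic, sin_IZR_periodic.
Qed.

Lemma Cnorm_teval_le (N : nat) (c : Z -> Cx) (x : R) : Cnorm (teval N c x) <= hat_l1 N c.
Proof.
eapply Rle_trans; [apply Cnorm_Csum|]. apply Rsumn_le; intros k _.
rewrite Cnorm_Cmul, Cnorm_ej; lra.
Qed.

(** A Bernstein-type estimate: differentiation multiplies the coefficient at [j] by [2 PI i j]. The
    condition concerns nonzero coefficients only, since [N] may exceed the degree. *)
Lemma Cnorm_dteval_le (N : nat) (c : Z -> Cx) (n x : R) :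
  (forall k, (k < 2 * N + 1)%nat -> c (idx N k) <> C0 -> Rabs (IZR (idx N k)) <= n) ->
  Cnorm (dteval N c x) <= 2 * PI * n * hat_l1 N c.
Proof.
intros Hn. eapply Rle_trans; [apply Cnorm_Csum|].
unfold hat_l1; rewrite <- Rsumn_scal. apply Rsumn_le; intros k Hk.
unfold dej. rewrite !Cnorm_Cmul, Cnorm_ej, Rmult_1_r, Rmult_comm.
destruct (classic (c (idx N k) = C0)) as [->|H0].
- rewrite Cnorm_C0; lra.
- apply Rmult_le_compat_r; [apply sqrt_pos|].
  unfold Cnorm; simpl fst; simpl snd.
  replace (0 ^ 2 + (2 * PI * IZR (idx N k)) ^ 2) with (Rsqr (2 * PI * IZR (idx N k)))
    by (unfold Rsqr; ring).
  generalize PI_RGT_0; intros Hpi.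
  rewrite sqrt_Rsqr_abs, Rabs_mult, (Rabs_pos_eq (2 * PI)) by lra.
  apply Rmult_le_compat_l; [lra|now apply Hn].
Qed.

(** * Frequencies and degree *)

Lemma In_freqs (N : nat) (c : Z -> Cx) (k : nat) :
  (k < 2 * N + 1)%nat -> c (idx N k) <> C0 -> In (idx N k) (freqs N c).
Proof.
intros Hk H0. apply filter_In; split.
- apply in_map, in_seq; lia.
- now destruct (excluded_middle_informative _).
Qed.

Lemma le_fold_max (l : list Z) (a j : Z) : In j (a :: l) -> (j <= fold_right Z.max a l)%Z.
Proof.
induction l as [|b l IH]; simpl; intros H; [lia|].
assert (j = b \/ j <= fold_right Z.max a l)%Z
  by (destruct H as [|[|]]; auto; right; apply IH; simpl; auto).
lia.
Qed.

Lemma fold_min_le (l : list Z) (a j : Z) : In j (a :: l) -> (fold_right Z.min a l <= j)%Z.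
Proof.
induction l as [|b l IH]; simpl; intros H; [lia|].
assert (j = b \/ fold_right Z.min a l <= j)%Z
  by (destruct H as [|[|]]; auto; right; apply IH; simpl; auto).
lia.
Qed.

Lemma Zabs_le_ndeg (N : nat) (c : Z -> Cx) (j : Z) :
  In j (freqs N c) -> (Z.abs j <= ndeg N c)%Z.
Proof.
unfold ndeg, nplus, nminus. destruct (freqs N c) as [|a l]; [easy|]. intros H.
generalize (le_fold_max l a j H) (fold_min_le l a j H). lia.
Qed.

(** If no nonzero frequency carried a nonzero coefficient, the polynomial would be constant. *)
Lemma ndeg_ge1 (N : nat) (c : Z -> Cx) :
  (exists x y : R, teval N c x <> teval N c y) -> (1 <= ndeg N c)%Z.
Proof.
intros [x [y Hxy]].
destruct (classic (exists k, (k < 2 * N + 1)%nat /\ c (idx N k) <> C0 /\ idx N k <> 0%Z))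
  as [[k [Hk [H0 Hj]]]|Hno].
- generalize (Zabs_le_ndeg N c _ (In_freqs N c k Hk H0)). lia.
- exfalso; apply Hxy, Csum_ext; intros k Hk.
  destruct (classic (c (idx N k) = C0)) as [->|H0].
  { unfold Cmul, C0; simpl; f_equal; ring. }
  destruct (Z.eq_dec (idx N k) 0) as [->|Hj]; [|exfalso; eauto].
  unfold ej. now rewrite !Rmult_0_r, !Rmult_0_l.
Qed.

(** * Modulus and argument in the right half-plane *)

Lemma fst_le_Cnorm (z : Cx) : fst z <= Cnorm z.
Proof.
eapply Rle_trans; [apply Rle_abs|]. unfold Cnorm.
rewrite <- sqrt_Rsqr_abs. apply sqrt_le_1_alt. unfold Rsqr. nra.
Qed.

Lemma Rabs_cross_le (z w : Cx) : Rabs (fst z * snd w - snd z * fst w) <= Cnorm z * Cnorm w.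
Proof.
rewrite <- (Rabs_pos_eq (Cnorm z * Cnorm w)) by (apply Rmult_le_pos; apply sqrt_pos).
apply Rsqr_le_abs_0. rewrite Rsqr_mult. unfold Cnorm.
rewrite !Rsqr_sqrt by nra. unfold Rsqr.
(* Lagrange's identity: the difference of the two squares is the square of this inner product. *)
generalize (pow2_ge_0 (fst z * fst w + snd z * snd w)); nra.
Qed.

Lemma continuous_ln_modulus (a b : R -> R) (x : R) :
  ex_derive a x -> ex_derive b x -> 0 < a x ->
  continuous (fun y => ln (sqrt (a y ^ 2 + b y ^ 2))) x.
Proof.
intros Ha Hb Hp. apply (ex_derive_continuous (V := R_NormedModule)).
assert (Hs : 0 < a x ^ 2 + b x ^ 2) by nra.
simpl in Hs. auto_derive. repeat split; try assumption. now apply sqrt_lt_R0.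
Qed.

(** With [t = a + i b], the derivative is [Im (t' / t)]. *)
Lemma is_derive_atan_div (a b : R -> R) (x da db : R) :
  is_derive a x da -> is_derive b x db -> 0 < a x ->
  is_derive (fun y => atan (b y / a y)) x ((a x * db - b x * da) / (a x ^ 2 + b x ^ 2)).
Proof.
intros Ha Hb Hp. evar_last.
- apply (is_derive_comp atan (fun y => b y / a y)); [apply is_derive_atan|].
  apply is_derive_div; [exact Hb|exact Ha|lra].
- unfold scal; simpl; unfold mult, Rsqr; simpl. field. split; nra.
Qed.

(** * The logarithm of a trigonometric polynomial with positive real part *)

Section PositiveRealPart.

Variables (N : nat) (c : Z -> Cx).
Hypothesis t_pos : forall x : R, 0 < fst (teval N c x).

Let t := teval N c.
Let m := minRe t.

Lemma is_lub_opp_Re : is_lub (fun r => exists x, r = - fst (t x)) (- m).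
Proof.
unfold m, minRe. rewrite Ropp_involutive.
apply is_lub_Rsup; [|exists (- fst (t 0)), 0; reflexivity].
exists 0; intros r [y ->]. generalize (t_pos y); unfold t; lra.
Qed.

Lemma minRe_le (x : R) : m <= fst (t x).
Proof.
generalize (proj1 is_lub_opp_Re (- fst (t x)) (ex_intro _ x eq_refl)). lra.
Qed.

(** Compactness of [0, 1] gives a point where the real part is minimal, and periodicity makes this
    minimum global. *)
Lemma minRe_pos : 0 < m.
Proof.
destruct (continuity_ab_min (fun y => fst (t y)) 0 1 Rle_0_1) as [y0 [Hy0 _]].
{ intros y _. apply continuity_pt_filterlim, (ex_derive_continuous (V := R_NormedModule)).
  eexists; apply is_derive_fst_teval. }
assert (Hper : forall (k : nat) y, t (y + INR k) = t y).
{ induction k as [|k IH]; intros y; [now rewrite Rplus_0_r|].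
  rewrite S_INR, <- Rplus_assoc. unfold t at 1. rewrite teval_periodic. apply IH. }
assert (Hall : forall y, fst (t y0) <= fst (t y)).
(* [up (- y)] exceeds [- y] by at most 1, so adding it to [y] lands in [0, 1]. *)
{ intros y. destruct (archimed (- y)) as [Ha1 Ha2].
  assert (Hz : exists y', 0 <= y' <= 1 /\ t y' = t y).
  { exists (y + IZR (up (- y))); split; [lra|].
    destruct (Z_le_gt_dec 0 (up (- y))) as [Hu|Hu].
    - rewrite <- (Z2Nat.id _ Hu), <- INR_IZR_INZ. apply Hper.
    - set (k := Z.to_nat (- up (- y))).
      replace (IZR (up (- y))) with (- INR k)
        by (unfold k; rewrite INR_IZR_INZ, Z2Nat.id, opp_IZR by lia; ring).
      rewrite <- (Hper k). f_equal; ring. }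
  destruct Hz as [y' [Hy' <-]]. now apply Hy0. }
assert (H : - m <= - fst (t y0)).
{ apply (proj2 is_lub_opp_Re). intros r [y ->]. generalize (Hall y); lra. }
generalize (t_pos y0). unfold t in *; lra.
Qed.

(** The bound by [hat_l1] ensures that [Rsup] is a true supremum and not its default 0. *)
Lemma le_supnorm (x : R) : Cnorm (t x) <= supnorm t.
Proof.
apply (is_lub_Rsup (fun r => exists x, r = Cnorm (t x))); [| |now exists x].
- exists (hat_l1 N c); intros r [y ->]. apply Cnorm_teval_le.
- now exists (Cnorm (t 0)), 0.
Qed.

Lemma Clog_teval (x : R) : Clog (t x) = (ln (Cnorm (t x)), atan (snd (t x) / fst (t x))).
Proof.
unfold Clog, Arg. destruct (Rlt_dec _ _) as [|H]; [reflexivity|].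
exfalso; apply H, t_pos.
Qed.

(** Uses the first entry of the maximum in [tau]; the positive summand [m / 2] only enlarges the
    logarithm. *)
Lemma fst_Clog_le_tau (x : R) : fst (Clog (t x)) <= tau N c.
Proof.
rewrite Clog_teval; simpl fst. eapply Rle_trans; [|apply Rmax_l].
assert (H := le_supnorm x). assert (Hm := minRe_pos).
assert (Hp : 0 < Cnorm (t x)) by (eapply Rlt_le_trans; [apply t_pos|apply fst_le_Cnorm]).
apply Rcomplements.ln_le; [exact Hp|]. fold t m. lra.
Qed.

Lemma continuous_fst_Clog (x : R) : continuous (fun y => fst (Clog (t y))) x.
Proof.
apply continuous_ext with (fun y => ln (sqrt (fst (t y) ^ 2 + snd (t y) ^ 2))).
{ intros y. now rewrite Clog_teval. }
apply (continuous_ln_modulus (fun y => fst (t y)) (fun y => snd (t y))).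
- eexists; apply is_derive_fst_teval.
- eexists; apply is_derive_snd_teval.
- apply t_pos.
Qed.

Lemma is_derive_snd_Clog (x : R) :
  is_derive (fun y => snd (Clog (t y))) x
    ((fst (t x) * snd (dteval N c x) - snd (t x) * fst (dteval N c x)) / Cnorm (t x) ^ 2).
Proof.
assert (Hp := t_pos x). fold t in Hp.
apply is_derive_ext with (fun y => atan (snd (t y) / fst (t y))).
{ intros y. now rewrite Clog_teval. }
unfold Cnorm. rewrite pow2_sqrt by nra.
apply (is_derive_atan_div (fun y => fst (t y)) (fun y => snd (t y)));
  [apply is_derive_fst_teval|apply is_derive_snd_teval|exact Hp].
Qed.

Lemma continuous_snd_Clog (x : R) : continuous (fun y => snd (Clog (t y))) x.
Proof.
apply (ex_derive_continuous (V := R_NormedModule)). eexists; apply is_derive_snd_Clog.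
Qed.

Lemma Rabs_snd_Clog_le (x : R) : Rabs (snd (Clog (t x))) <= PI / 2.
Proof.
rewrite Clog_teval; simpl snd. apply Rabs_le.
generalize (atan_bound (snd (t x) / fst (t x))); lra.
Qed.

(** The derivative [Im (t' / t)] is at most [|t'| / |t|], with [|t'|] bounded by [Cnorm_dteval_le]
    and [|t|] at least its real part, hence at least [m]. *)
Lemma snd_Clog_Lipschitz (y z : R) :
  Rabs (snd (Clog (t y)) - snd (Clog (t z)))
    <= 2 * PI * IZR (ndeg N c) * hat_l1 N c / m * Rabs (y - z).
Proof.
apply (bounded_variation (fun y => snd (Clog (t y)))) with
  (dh := fun x => (fst (t x) * snd (dteval N c x) - snd (t x) * fst (dteval N c x))
                  / Cnorm (t x) ^ 2).
intros x _. split; [apply is_derive_snd_Clog|].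
assert (Hm := minRe_pos).
assert (Hr : m <= Cnorm (t x)) by (eapply Rle_trans; [apply minRe_le|apply fst_le_Cnorm]).
assert (Hd : Cnorm (dteval N c x) <= 2 * PI * IZR (ndeg N c) * hat_l1 N c).
{ apply Cnorm_dteval_le. intros k Hk H0. rewrite <- abs_IZR. apply IZR_le.
  now apply Zabs_le_ndeg, In_freqs. }
assert (Hd0 : 0 <= Cnorm (dteval N c x)) by apply sqrt_pos.
assert (Hc := Rabs_cross_le (t x) (dteval N c x)).
unfold Rdiv. rewrite Rabs_mult, (Rabs_pos_eq (/ Cnorm (t x) ^ 2))
  by (apply Rlt_le, Rinv_0_lt_compat; nra).
apply Rle_trans with (Cnorm (dteval N c x) * / Cnorm (t x)).
- replace (Cnorm (dteval N c x) * / Cnorm (t x))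
    with (Cnorm (t x) * Cnorm (dteval N c x) * / Cnorm (t x) ^ 2) by (field; lra).
  apply Rmult_le_compat_r; [apply Rlt_le, Rinv_0_lt_compat; nra|exact Hc].
- apply Rmult_le_compat; [exact Hd0| |exact Hd|now apply Rinv_le_contravar].
  apply Rlt_le, Rinv_0_lt_compat; lra.
Qed.

(** [rho] is at most the second entry of its minimum; solving that inequality for [hat_l1 N c / m]
    gives the bound. *)
Lemma hat_l1_div_minRe_le : 0 < rho N c /\ hat_l1 N c / m <= 1 / (2 * exp 1 * rho N c).
Proof.
assert (Hm := minRe_pos). assert (He := exp_pos 1).
assert (HS : 0 < hat_l1 N c).
{ eapply Rlt_le_trans; [apply (t_pos 0)|].
  eapply Rle_trans; [apply fst_le_Cnorm|apply Cnorm_teval_le]. }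
assert (Hq : 0 < m / (2 * exp 1 * hat_l1 N c)) by (apply Rdiv_lt_0_compat; nra).
assert (H0 : 0 < rho N c) by (apply Rmin_glb_lt; [lra|exact Hq]).
split; [exact H0|].
assert (Hr : rho N c <= m / (2 * exp 1 * hat_l1 N c)) by apply Rmin_r.
apply Rmult_le_compat_r with (r := 2 * exp 1 * hat_l1 N c) in Hr; [|nra].
replace (m / (2 * exp 1 * hat_l1 N c) * (2 * exp 1 * hat_l1 N c)) with m in Hr by (field; lra).
apply Rmult_le_reg_r with (m * (2 * exp 1 * rho N c)); [apply Rmult_lt_0_compat; nra|].
replace (hat_l1 N c / m * (m * (2 * exp 1 * rho N c)))
  with (rho N c * (2 * exp 1 * hat_l1 N c)) by (field; lra).
replace (1 / (2 * exp 1 * rho N c) * (m * (2 * exp 1 * rho N c))) with m by (field; lra).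
exact Hr.
Qed.

End PositiveRealPart.

(** * From the exponent to the bound on [Psi] *)

Lemma Cnorm_Cexp (z : Cx) : Cnorm (Cexp z) = exp (fst z).
Proof.
unfold Cnorm, Cexp; simpl fst; simpl snd.
replace ((exp (fst z) * cos (snd z)) ^ 2 + (exp (fst z) * sin (snd z)) ^ 2)
  with (Rsqr (exp (fst z)) * (Rsqr (sin (snd z)) + Rsqr (cos (snd z))))
  by (unfold Rsqr; ring).
rewrite sin2_cos2, Rmult_1_r. apply sqrt_Rsqr, Rlt_le, exp_pos.
Qed.

Theorem theorem2 :
  exists lam : R -> R -> R,
    (forall a b : R, 0 < a -> 0 < b -> 0 < lam a b) /\
    forall (N : nat) (c : Z -> Cx) (s : bool),
      supported N c ->
      (exists x y : R, teval N c x <> teval N c y) ->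
      (forall x : R, 0 < fst (teval N c x)) ->
      forall x : R,
        Cnorm (Psi s (teval N c) x)
          <= lam (rho N c) (tau N c) * Rpower (IZR (ndeg N c)) (PI / 2).
Proof.
(* [b / 2] is the Fejer contribution [T / 2] with [T = tau N c]; [PI / (2 * exp 1 * a)] bounds the
   near contribution [L / (2 n)] in terms of [rho N c]. *)
exists (fun a b => exp (b / 2 + PI / (2 * exp 1 * a))).
split; [intros; apply exp_pos|].
intros N c s _ Hnc Hpos x.
assert (Hn : 1 <= IZR (ndeg N c)) by (apply IZR_le, ndeg_ge1, Hnc).
(* Both sides become exponentials, so it suffices to compare exponents. *)
unfold Psi, Rpower. rewrite Cnorm_Cexp, <- exp_plus.
destruct (hat_l1_div_minRe_le N c Hpos) as [Hr HS].
assert (Hm := minRe_pos N c Hpos).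
enough (H : fst (Ainf s (fun y => Clog (teval N c y)) x)
            <= tau N c / 2 + PI / (2 * exp 1 * rho N c) + PI / 2 * ln (IZR (ndeg N c)))
  by (destruct H as [H| ->]; [left; now apply exp_increasing|right; reflexivity]).
eapply Rle_trans.
- apply fst_Ainf_bound with (T := tau N c) (n := IZR (ndeg N c))
    (L := 2 * PI * IZR (ndeg N c) * hat_l1 N c / minRe (teval N c)); [| | | | | |exact Hn].
  + now apply continuous_fst_Clog.
  + now apply continuous_snd_Clog.
  + intros y. now rewrite teval_periodic.
  + now apply fst_Clog_le_tau.
  + now apply Rabs_snd_Clog_le.
  + now apply snd_Clog_Lipschitz.
(* The degree in the Lipschitz constant cancels against the cut, leaving a quantity controlled by
   [rho N c] alone. *)
- replace (2 * PI * IZR (ndeg N c) * hat_l1 N c / minRe (teval N c) / (2 * IZR (ndeg N c)))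
    with (PI * (hat_l1 N c / minRe (teval N c))) by (field; lra).
  replace (PI / (2 * exp 1 * rho N c)) with (PI * (1 / (2 * exp 1 * rho N c)))
    by (field; generalize (exp_pos 1); lra).
  apply Rmult_le_compat_l with (r := PI) in HS; [lra|generalize PI_RGT_0; lra].
Qed.
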